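(* Let $d\ge 2$ and let $\widehat F_d$ be the free profinite group of rank $d$. Let $w$ be a word in $k$ variables and let $p$ be a prime such that the word map of $w$ is not surjective on the free pro-$p$ group $H_{p,d}$ of rank $d$. If $k+1\le d$, then the image $\{w(\boldsymbol h)\mid\boldsymbol h\in\widehat F_d^{\,k}\}$ of $w$ in $\widehat F_d$ has Haar measure zero.
   Context: A word in $k$ variables is an element of the abstract free group $F_k$ on $k$ generators; it induces a word map $G^k\to G$ on every group $G$ by substitution. Haar measure on a profinite group is normalised to have total mass $1$. *)

(* Defs.v *)
From HB Require Import structures.
From mathcomp Require Import all_boot.
From mathcomp Require Import all_classical all_reals all_analysis.

Set Implicit Arguments.
Unset Strict Implicit.
Unset Printing Implicit Defensive.

Local Open Scope classical_set_scope.
Local Open Scope group_scope.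

HB.mixin Record Group_isTopologicalGroup G of Topological G & Group G := {
  mulg_continuous : continuous (fun x : G * G => x.1 * x.2);
  invg_continuous : continuous (fun x : G => x^-1)
}.

#[short(type="topologicalGroupType")]
HB.structure Definition TopologicalGroup :=
  {G of Topological G & Group G & Group_isTopologicalGroup G}.

(* Elements of the free group on k generators, in normal form: the letter      *)
(* (i, false) is the i-th generator and (i, true) its inverse, and a word is   *)
(* reduced when no two adjacent letters are inverse to each other.             *)
Definition reduced k (s : seq ('I_k * bool)) : bool :=
  sorted [rel a b | (a.1 == b.1) ==> (a.2 == b.2)] s.

Definition word k := {s : seq ('I_k * bool) | reduced s}.

Definition word_map k (w : word k) (G : groupType) (h : 'I_k -> G) : G :=
  \prod_(a <- sval w) (if a.2 then (h a.1)^-1 else h a.1).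

Definition profinite (G : topologicalGroupType) : Prop :=
  [/\ compact [set: G], hausdorff_space G & totally_disconnected [set: G]].

Definition normal_subgroup (G : groupType) (U : set G) : Prop :=
  [/\ U 1, forall x y, U x -> U y -> U (x / y) & forall x g, U x -> U (x ^ g)].

Definition left_cosets (G : groupType) (U : set G) : set (set G) :=
  [set [set x * u | u in U] | x in [set: G]].

Definition pro_p (p : nat) (G : topologicalGroupType) : Prop :=
  profinite G /\
  forall U : set G, open U -> normal_subgroup U ->
    exists n : nat, (left_cosets U #= `I_(p ^ n)%N)%card.

Definition continuous_morphism (G H : topologicalGroupType) (f : G -> H) : Prop :=
  {morph f : x y / x * y} /\ continuous f.

(* F is free with basis x : 'I_d -> F in the class C of topological groups. *)
Definition free_in (C : topologicalGroupType -> Prop) d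
    (F : topologicalGroupType) (x : 'I_d -> F) : Prop :=
  C F /\
  forall (G : topologicalGroupType) (y : 'I_d -> G), C G ->
    exists! f : F -> G, continuous_morphism f /\ (forall i, f (x i) = y i).

Definition free_profinite d (F : topologicalGroupType) : Prop :=
  exists x : 'I_d -> F, free_in profinite x.

Definition free_pro_p p d (H : topologicalGroupType) : Prop :=
  exists x : 'I_d -> H, free_in (pro_p p) x.

(* measurableType requires a pointed carrier; this copy of G is pointed at 1. *)
Definition pointed_group (G : topologicalGroupType) : Type := G.

HB.instance Definition _ (G : topologicalGroupType) :=
  Choice.on (pointed_group G).
HB.instance Definition _ (G : topologicalGroupType) :=
  isPointed.Build (pointed_group G) (1 : G).

Notation borel G :=
  (g_sigma_algebraType (@open G : set (set (pointed_group G)))).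

(* Outer regularity is part of the definition so that the normalised Haar      *)
(* measure is unique on every compact group.                                   *)
Definition haar_measure (R : realType) (G : topologicalGroupType)
    (mu : probability (borel G) R) : Prop :=
  (forall (g : G) (A : set (borel G)), measurable A ->
     mu [set g * (a : G) | a in A] = mu A) /\
  (forall A : set (borel G), measurable A ->
     mu A = ereal_inf [set mu U | U in [set U : set G | open U /\ A `<=` U]]).

(* Main.v *)
(* If some exponent sum e of w is prime to p, then g |-> g ^+ e is onto every  *)
(* pro-p group (Bezout modulo each open normal subgroup, then compactness), so *)
(* w is onto. Hence every exponent sum of w vanishes modulo p, and w vanishes  *)
(* on tuples taken from an elementary abelian p-group.                         *)
(* Let q be a prime and h a k-tuple in F. As k < d, some nonzero chi in F_q^d  *)
(* is orthogonal to the images of the h m in F_q^d. The map F -> F_q given by  *)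
(* chi lifts to a map phi from F to F_p wr F_q whose image contains all the    *)
(* functions F_q -> F_p of sum zero. Each phi (h m) lies in the base group, so *)
(* w h lies in the kernel of phi, which has measure at most p^(1-q). There are *)
(* q^d choices of chi, and q^d * p^(1-q) tends to 0.                           *)
Require Import Defs.
From HB Require Import structures.
From mathcomp Require Import all_boot all_order all_algebra finmap.
From mathcomp Require Import all_classical all_reals all_analysis.

Set Implicit Arguments.
Unset Strict Implicit.
Unset Printing Implicit Defensive.

Import Order.TTheory GRing.Theory Num.Theory.

Local Open Scope classical_set_scope.
Local Open Scope group_scope.

(** For every prime [q] the image of [w] is covered by [q ^ d] sets of measure at most
    [p ^ (1 - q)]; letting [q] grow gives measure zero. In a pro-p group every element has an [e]-th
    root when [e] is prime to [p] ([pro_p_root]), so a word that is not onto has all exponent sums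
    zero in ['F_p] ([exponent_sum_eq0]) and is trivial on the elementary abelian base group of the
    wreath product of ['F_p] by ['F_q] ([word_map_wreath]). Fewer than [d] vectors of [F_q^d] have a
    common nonzero annihilator [chi] ([exists_col_annihilator]), so each tuple is sent into that
    base group by one of finitely many homomorphisms, and its word value lies in the kernel
    ([word_image_cover]). Such a kernel is small because the homomorphism has a large image
    ([haar_kernel_le], [wreath_kernel_le]), and [exists_prime_expn_ge] chooses [q]. *)

(** * Powers modulo a normal subgroup of finite index *)

Lemma order_le_iter (T : finType) (f : T -> T) (x : T) n :
  (0 < n)%N -> iter n f x = x -> (fingraph.order f x <= n)%N.
Proof.
move=> n0 fx; rewrite -[n in (_ <= n)%N](size_traject f x).
apply: order_le_cycle; last by case: n n0 {fx} => //= n _; rewrite mem_head.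
case: n n0 fx => // n _ fx; rewrite /= -[X in rcons _ X]fx iterSr -trajectSr.
exact: fpath_traject.
Qed.

(** Lagrange for a quotient of a possibly infinite group: [g] permutes the [m] cosets by left
    translation, and by normality [g ^+ n] fixes one coset iff it lies in [U]. All orbits thus have
    one length [r], which divides [m], and [g ^+ r] is in [U]. *)
Lemma normal_index_exp (G : groupType) (U : set G) m (g : G) :
  normal_subgroup U -> (left_cosets U #= `I_m)%card -> U (g ^+ m).
Proof.
move=> [U1 UV UJ] Um.
have UI x : U x -> U x^-1 by move=> Ux; rewrite -div1g; exact: UV.
have UM x y : U x -> U y -> U (x * y).
  by move=> Ux Uy; rewrite -[y]invgK; apply: UV => //; exact: UI.
have finC : finite_set (left_cosets U) by apply/finite_setP; exists m.
pose T : finType := finmap.fset_sub_type (fset_set (left_cosets U)).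
have TP (t : T) : left_cosets U (val t).
  by have := valP t; rewrite in_fset_set// inE.
have fP (t : T) : [set g * x | x in val t] \in fset_set (left_cosets U).
  have [x _ xt] := TP t; rewrite in_fset_set// inE; exists (g * x) => //.
  rewrite -xt; apply/seteqP; split=> [z [u Uu <-]|z [y [u Uu <-] <-]].
    by exists (x * u); rewrite ?mulgA//; exists u.
  by exists u => //; rewrite mulgA.
pose f (t : T) : T := FSetSub (fP t).
have iterE n t : val (iter n f t) = [set g ^+ n * x | x in val t].
  elim: n => [|n IH] /=.
    rewrite expg0; apply/seteqP; split=> [z tz|z [y ty <-]].
      by exists z => //; rewrite mul1g.
    by rewrite mul1g.
  rewrite IH; apply/seteqP; split=> [z [y [x tx <-] <-]|z [x tx <-]].
    by exists x => //; rewrite expgS mulgA.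
  by exists (g ^+ n * x); [exists x|rewrite expgS mulgA].
have iterP n t : U (g ^+ n) <-> iter n f t = t.
  have [x _ xt] := TP t.
  have xx : val t x by rewrite -xt; exists 1; rewrite ?mulg1.
  split=> [Ug|nt].
    apply: val_inj; rewrite iterE -xt; apply/seteqP; split.
      move=> z [y [u Uu <-] <-]; exists ((g ^+ n) ^ x * u).
        by apply: UM => //; exact: UJ.
      by rewrite conjgE !mulgA mulgV mul1g.
    move=> z [u Uu <-]; exists (x * ((g ^+ n)^-1 ^ x * u)).
      exists ((g ^+ n)^-1 ^ x * u) => //.
      by apply: UM => //; apply: UJ; exact: UI.
    by rewrite conjgE !mulgA mulgK mulgV mul1g.
  have : val t (g ^+ n * x) by rewrite -{1}nt iterE; exists x.
  rewrite -{1}xt => -[u Uu] /(congr1 (fun z => z * x^-1)).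
  by rewrite mulgK => <-; rewrite -mulgA -{1}[x]invgK; exact: (UJ u x^-1).
have f_inj : injective f.
  move=> s t /(congr1 val)/= st; apply: val_inj; apply/seteqP; split=> z.
    move=> sz; have : [set g * x | x in val t] (g * z) by rewrite -st; exists z.
    by move=> [y ty /mulgI <-].
  move=> tz; have : [set g * x | x in val s] (g * z) by rewrite st; exists z.
  by move=> [y ty /mulgI <-].
have t0P : [set 1 * x | x in U] \in fset_set (left_cosets U).
  by rewrite in_fset_set// inE; exists 1.
pose t0 : T := FSetSub t0P; pose r := fingraph.order f t0.
have oP (s t : T) : (fingraph.order f s <= fingraph.order f t)%N.
  by apply: order_le_iter => //; apply/iterP/(iterP _ t)/iter_order.
have Tm : #|T| = m.
  rewrite -cardfE; exact: card_fset_set.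
have rm : (r %| m)%N.
  rewrite -Tm -(@fcard_order_set _ f f_inj r T) ?dvdn_mull//.
  by apply/fintype.subsetP => t _; rewrite inE eqn_leq !oP.
have Ur : U (g ^+ r) by apply/(iterP _ t0)/iter_order.
move: rm => /dvdnP[c ->]; rewrite mulnC expgnA.
by elim: c => [//|c IH]; rewrite expgS; exact: UM.
Qed.

(** * Clopen sets and open normal subgroups of profinite groups *)

(** If no clopen neighbourhood [D] of [x] were inside [W], the sets [D] minus [W] would generate a
    proper filter; a cluster point would lie in every such [D] but not in the open set [W]. *)
Lemma compact_clopen_sub (T : topologicalType) (x : T) (W : set T) :
  compact [set: T] -> open W ->
  (forall z, (forall D, clopen D -> D x -> D z) -> W z) ->
  exists D, [/\ clopen D, D x & D `<=` W].
Proof.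
move=> cT oW QW; apply: contrapT => noD.
pose G := filter_from [set D : set T | clopen D /\ D x] (fun D => D `\` W).
have PG : ProperFilter G.
  apply: filter_from_proper.
    apply: filter_from_filter; first by exists setT; split=> //; exact: clopenT.
    move=> A B [cA Ax] [cB Bx]; exists (A `&` B).
      by split; [exact: clopenI|].
    by move=> z [[Az Bz] Wz].
  move=> D [cD Dx]; apply: contrapT => D0; apply: noD; exists D; split=> //.
  by move=> z Dz; apply: contrapT => Wz; apply: D0; exists z.
have [|z [_ zG]] := cT G PG; first exact: filterT.
suff Wz : W z.
  have [|t [nWt /nWt//]] := zG (~` W) W _ (open_nbhs_nbhs (conj oW Wz)).
  by exists setT; [split=> //; exact: clopenT|move=> t []].
apply: QW => D [oD cD] Dx; apply: contrapT => nDz.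
have [||t [Dt //]] := zG D (~` D).
- by exists D => //= t [].
- by apply: open_nbhs_nbhs; split=> //; exact: closed_openC.
Qed.

(** In a compact Hausdorff space the quasi-component [Q] of [x] is connected, so it is contained in
    the component of [x], here a single point. *)
Lemma compact_totally_disconnected_zero_dimensional (T : topologicalType) :
  compact [set: T] -> hausdorff_space T -> totally_disconnected [set: T] ->
  zero_dimensional T.
Proof.
move=> cT hT tdT x y /eqP xy; apply: contrapT => noU.
pose Q := [set z : T | forall D, clopen D -> D x -> D z].
have Qx : Q x by [].
have Qy : Q y.
  by move=> D cD Dx; apply: contrapT => nDy; apply: noU; exists D.
have cQ : closed Q.
  have -> : Q = \bigcap_(D in [set D | clopen D /\ D x]) D.
    apply/seteqP; split=> [z Qz D [cD Dx]|z Qz D cD Dx]; first exact: Qz.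
    exact: Qz.
  by apply: closed_bigI => D [[]].
suff : connected Q.
  move=> /(connected_component_max Qx (@subsetT _ Q))/(_ y Qy).
  by rewrite tdT// => yx; apply: xy.
apply/connectedP => E [E0 QE [sE1 sE2]].
wlog Ex : E E0 QE sE1 sE2 / E false x.
  move=> wl; have := Qx; rewrite QE => -[|Etx]; first exact: (wl E).
  apply: (wl (E \o negb)) => //=.
  - by rewrite setUC.
  - by rewrite setIC.
  - by rewrite setIC.
have EQ b : E b `<=` Q by rewrite QE; case: b => z Ez; [right|left].
have cE b : closed (E b).
  move=> z Ebz; have /cQ : closure Q z by apply: closureS Ebz; exact: EQ.
  rewrite QE; case: b Ebz => Ebz [] // Ez.
  - by have : (E false `&` closure (E true)) z by []; rewrite sE2.
  - by have : (closure (E false) `&` E true) z by []; rewrite sE1.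
have E01 : E false `<=` ~` E true.
  move=> z Ez Ez'; have : (closure (E false) `&` E true) z; last by rewrite sE1.
  by split=> //; exact: subset_closure.
(* Normality separates the two closed pieces of [Q] by disjoint open sets [U] and [V]; a clopen [D]
   around [x] fits in their union, and [D] meets [U] in a clopen set that contains [x] but misses
   [E true]. *)
have /(compact_normal hT cT (cE false)) : set_nbhs (E false) (~` E true).
  by apply/set_nbhsP; exists (~` E true); split=> //; exact: closed_openC.
move=> [B /set_nbhsP[U [oU EU UB]] Bsub].
pose V := ~` closure B.
have oV : open V by apply: closed_openC; exact: closed_closure.
have UV z : U z -> V z -> False.
  by move=> Uz; apply; exact/subset_closure/UB.
have [||D [[oD cD] Dx DUV]] := @compact_clopen_sub T x (U `|` V) cT.
- exact: openU.
- move=> z Qz; have : Q z by [].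
  rewrite QE => -[Ez|Ez]; [left|right]; first exact: EU.
  by move=> /Bsub.
have [z Ez] := E0 true.
have : (D `&` U) z.
  apply: (EQ true _ Ez) => //; last by split=> //; exact: EU.
  split; first exact: openI.
  have -> : D `&` U = D `&` ~` V.
    apply/seteqP; split=> t [Dt].
      by move=> Ut; split=> // /(UV _ Ut).
    by move=> nVt; split=> //; case: (DUV _ Dt).
  by apply: closedI => //; exact: open_closedC.
by move=> [_ /UB/subset_closure/Bsub].
Qed.

Lemma continuous_mulg (T : topologicalType) (G : topologicalGroupType)
    (f g : T -> G) :
  continuous f -> continuous g -> continuous (fun x => f x * g x).
Proof.
move=> cf cg x.
apply: (continuous_comp (f := fun z => (f z, g z)) (g := fun p => p.1 * p.2)).
  by apply: cvg_pair; [exact: cf|exact: cg].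
exact: mulg_continuous.
Qed.

Lemma continuous_invg (T : topologicalType) (G : topologicalGroupType)
    (f : T -> G) :
  continuous f -> continuous (fun x => (f x)^-1).
Proof.
move=> cf x; apply: (continuous_comp (f := f) (g := fun y : G => y^-1)).
  exact: cf.
exact: invg_continuous.
Qed.

Lemma profinite_open_normal (G : topologicalGroupType) (W : set G) :
  profinite G -> nbhs 1 W ->
  exists U, [/\ open U, normal_subgroup U & U `<=` W].
Proof.
move=> [cG hG tdG] W1.
have zG := compact_totally_disconnected_zero_dimensional cG hG tdG.
have [D [D1 [oD cD]] DW] := zero_dimensional_cvg hG zG cG W1.
(* The x all of whose conjugates preserve D under right translation form a *)
(* normal subgroup inside D, which is open by the tube lemma.             *)
pose f (z : G * (G * G)) := z.2.2 * z.1 ^ z.2.1.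
have cf2 : continuous (fun z : G * (G * G) => z.2.2).
  move=> z; apply: (continuous_comp (f := snd) (g := snd)); exact: cvg_snd.
have cf1 : continuous (fun z : G * (G * G) => z.2.1).
  move=> z; apply: (continuous_comp (f := snd) (g := fst)).
    exact: cvg_snd.
  exact: cvg_fst.
have cf : continuous f.
  apply: continuous_mulg => //; apply: continuous_mulg.
    exact: continuous_invg.
  by apply: continuous_mulg => // z; exact: cvg_fst.
pose P (x : G) (y : G * G) := D y.2 <-> D (y.2 * x ^ y.1).
have oP : open [set z : G * (G * G) | P z.1 z.2].
  have -> : [set z : G * (G * G) | P z.1 z.2] =
      ((fun z => z.2.2) @^-1` D `&` f @^-1` D) `|`
      ((fun z => z.2.2) @^-1` (~` D) `&` f @^-1` (~` D)).
    apply/seteqP; split=> -[x y]; rewrite /P /f /=; last first.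
      by case=> -[? ?]; split.
    by have [Dy|nDy] := pselect (D y.2) => yE; [left|right]; split=> //; tauto.
  have oDC := closed_openC cD.
  have op (h : G * (G * G) -> G) E : continuous h -> open E -> open (h @^-1` E).
    by move=> /continuousP; apply.
  by apply: openU; apply: openI; apply: op.
pose U := [set x | forall y, P x y].
exists U; split.
- rewrite openE => x Ux.
  have cGG : compact ([set: G] `*` [set: G]) by exact: compact_setX.
  have /compact_near_coveringP ncGG := cGG.
  have PN : \forall i \near x, [set: G] `*` [set: G] `<=` P i.
    apply: ncGG => y _.
    have := oP; rewrite openE => /(_ (x, y) (Ux y)); rewrite /interior/=.
    case=> -[A B] /= [xA yB] AB; exists (B, A) => //= -[b a] [/= Bb Aa].
    exact: (AB (a, b)).
  by apply: filterS PN => i Pi y; exact: Pi.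
- split.
  + move=> y; by rewrite /P conj1g mulg1.
  + move=> a b Ua Ub [g h]; rewrite /P /=.
    have := Ub (g, h * (a / b) ^ g); rewrite /P /= -mulgA -conjMg divgK.
    by have := Ua (g, h); rewrite /P /=; tauto.
  + move=> a b Ua [g h]; have := Ua (b * g, h).
    by rewrite /P /= conjgM.
- move=> x /(_ (1, 1)); rewrite /P /= conjg1 mul1g => -[+ _].
  by move=> /(_ D1) Dx; exact: DW.
Qed.

(** * Power maps, word maps, and roots in pro-p groups *)

Lemma continuous_expg (G : topologicalGroupType) n :
  continuous (fun x : G => x ^+ n).
Proof.
elim: n => [|n IH]; first by move=> x; exact: cvg_cst.
have -> : (fun x : G => x ^+ n.+1) = (fun x => x * x ^+ n).
  by apply/funext => x; rewrite expgS.
by apply: continuous_mulg => // x; exact: cvg_id.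
Qed.

Lemma continuous_word_map k (w : word k) (G : topologicalGroupType) :
  continuous (@word_map k w G : prod_topology (fun _ : 'I_k => G) -> G).
Proof.
rewrite /word_map; elim: (sval w : seq _) => [|a s IH].
  have -> : (fun h : 'I_k -> G => \prod_(a <- [::])
      (if a.2 then (h a.1)^-1 else h a.1)) = fun=> 1.
      by apply/funext => h; rewrite big_nil.
  by move=> h; exact: (@cst_continuous (prod_topology (fun _ : 'I_k => G))).
have -> : (fun h : 'I_k -> G => \prod_(a <- a :: s)
      (if a.2 then (h a.1)^-1 else h a.1)) =
    fun h => (if a.2 then (h a.1)^-1 else h a.1) *
      \prod_(a <- s) (if a.2 then (h a.1)^-1 else h a.1).
  by apply/funext => h; rewrite big_cons.
have ca := @proj_continuous _ (fun _ : 'I_k => G) a.1.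
apply: continuous_mulg => //.
by case: a.2 => //; exact: continuous_invg.
Qed.

Lemma compact_range_word_map k (w : word k) (G : topologicalGroupType) :
  compact [set: G] -> compact (range (@word_map k w G)).
Proof.
move=> cG.
have ck : compact [set: prod_topology (fun _ : 'I_k => G)].
  have := @tychonoff _ (fun _ : 'I_k => G) (fun=> setT) (fun=> cG).
  by congr compact; apply/seteqP; split.
apply: (@continuous_compact (prod_topology (fun _ : 'I_k => G))) => //.
exact/continuous_subspaceT/continuous_word_map.
Qed.

(** The set [C] of [e]-th powers is closed. If it missed [g], it would miss a coset of an open
    normal [U] of index [p ^ n]; but Bezout gives [u * e = 1 + p ^ n * v], so [(g ^+ u) ^+ e] is in
    that coset. *)
Lemma pro_p_root p (G : topologicalGroupType) e (g : G) :
  prime p -> pro_p p G -> coprime e p -> exists x, x ^+ e = g.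
Proof.
move=> pp [[cG hG tG] pG] ep.
pose C := range (fun x : G => x ^+ e).
have cC : closed C.
  apply: compact_closed => //; apply: continuous_compact => //.
  exact/continuous_subspaceT/continuous_expg.
suff : C g by move=> [x _ <-]; exists x.
apply: contrapT => nCg.
have gC : nbhs 1 ((fun x => g * x) @^-1` (~` C)).
  apply: (@continuous_mulg _ _ (fun=> g) id).
  - by move=> x; exact: cvg_cst.
  - by move=> x; exact: cvg_id.
  - apply: open_nbhs_nbhs; split; first exact: closed_openC.
    by rewrite /= mulg1.
have [U [oU nU UC]] := profinite_open_normal (And3 cG hG tG) gC.
have [n Un] := pG U oU nU.
have Ug := normal_index_exp g nU Un.
have epn : coprime e (p ^ n) by rewrite coprimeXr.
have e0 : (0 < e)%N.
  case: e ep {C cC nCg gC UC epn} => //; rewrite /coprime gcd0n => /eqP p1.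
  by move: pp; rewrite p1.
have [u ue] := coprimeP _ e0 epn.
have {}ue : (u.1 * e = 1 + p ^ n * u.2)%N 
  by rewrite -ue (mulnC (p ^ n)%N) subnK// ltnW// -subn_gt0 ue.
have : U ((g ^+ (p ^ n)%N) ^+ u.2).
  case: nU => U1 UV _; elim: u.2 => [//|c IH].
  rewrite expgSr -[X in _ * X]invgK; apply: (UV _ _ IH).
  by rewrite -div1g; exact: UV.
move=> /UC; apply; exists (g ^+ u.1) => //.
by rewrite -!expgnA ue expgnDr.
Qed.

(** * Exponent sums *)

(** The ring is a parameter so that the sum can be read modulo [p], in ['F_p]. *)
Definition exponent_sum (R : pzRingType) k (w : word k) (i : 'I_k) : R :=
  (\sum_(a <- sval w | a.1 == i) (-1) ^+ a.2)%R.

Lemma exponent_sumE (R : pzRingType) k (w : word k) (i : 'I_k) :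
  exponent_sum R w i =
  ((count_mem (i, false) (sval w))%:R - (count_mem (i, true) (sval w))%:R)%R.
Proof.
rewrite /exponent_sum; elim: (sval w : seq _) => [|[j b] s IH] /=.
  by rewrite big_nil GRing.subr0.
rewrite big_cons /= IH !xpair_eqE; case: eqP => _ /=; last by rewrite !add0n.
case: b => /=; rewrite !add0n !natrD ?expr0 ?expr1 -?addrA //.
by rewrite opprD addrCA.
Qed.

Lemma word_map_single k (w : word k) (G : groupType) (i : 'I_k) (g : G) :
  word_map w (fun j => if j == i then g else 1) =
  g ^+ count_mem (i, false) (sval w) / g ^+ count_mem (i, true) (sval w).
Proof.
rewrite /word_map; elim: (sval w : seq _) => [|[j b] s IH] /=.
  by rewrite big_nil divg1.
rewrite big_cons /= IH !xpair_eqE; case: eqP => _ /=; last first.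
  by case: b; rewrite ?invg1 mul1g.
case: b => /=; rewrite !add0n; last by rewrite add1n expgS mulgA.
set A := count_mem _ s; set B := count_mem _ s.
have gc : commute g^-1 (g ^+ A / g ^+ B).
  apply/commute_sym/commuteV/commute_sym/commuteM; first exact/commuteX.
  exact/commuteV/commuteX.
by rewrite gc add1n expgS invgM !mulgA.
Qed.

Lemma word_map_pro_p_surj p k (w : word k) (H : topologicalGroupType)
    (i : 'I_k) (g : H) :
  prime p -> pro_p p H -> exponent_sum 'F_p w i <> 0%R ->
  exists h : 'I_k -> H, word_map w h = g.
Proof.
move=> pp pH; rewrite exponent_sumE.
set a := count_mem _ _; set b := count_mem _ _ => ab.
have cop e : (e%:R)%R <> 0%R :> 'F_p -> coprime e p.
  move=> e0; rewrite coprime_sym prime_coprime// (dvdn_pcharf (pchar_Fp pp)).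
  exact/eqP.
have [ba|/ltnW ba] := leqP b a.
  have [|x xe] := @pro_p_root p H (a - b) g pp pH.
    by apply: cop; rewrite natrB.
  exists (fun j => if j == i then x else 1).
  by rewrite word_map_single -/a -/b -expgnFr.
(* The integer exponent sum is negative here, so a root of the inverse is taken. *)
have [|x xe] := @pro_p_root p H (b - a) g^-1 pp pH.
  by apply: cop; rewrite natrB// => /eqP; rewrite -oppr_eq0 opprB => /eqP.
exists (fun j => if j == i then x else 1).
rewrite word_map_single -/a -/b -[LHS]invgK invgF -expgnFr// xe invgK.
by [].
Qed.

(** * Finite discrete groups and wreath products *)

HB.instance Definition _ (G : groupType) := Group.copy (discrete_topology G) G.

Lemma discrete_mulg_continuous (G : groupType) :
  continuous (fun x : discrete_topology G * discrete_topology G => x.1 * x.2).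
Proof.
move=> [x y] A /= /nbhs_singleton Axy.
exists ([set x], [set y]); first by split; exact: discrete_set1.
by move=> [a b] [/= -> ->].
Qed.

Lemma discrete_invg_continuous (G : groupType) :
  continuous (fun x : discrete_topology G => x^-1).
Proof.
move=> x A /= /nbhs_singleton Ax.
apply: (@filterS _ (nbhs x) _ [set x]); last exact: discrete_set1.
by move=> y ->.
Qed.

HB.instance Definition _ (G : groupType) :=
  Group_isTopologicalGroup.Build (discrete_topology G)
    (@discrete_mulg_continuous G) (@discrete_invg_continuous G).

Lemma finite_discrete_profinite (G : groupType) :
  finite_set [set: G] -> profinite (discrete_topology G).
Proof.
move=> finG; split; first exact: finite_compact.
  exact: discrete_hausdorff.
exact/zero_dimension_totally_disconnected/discrete_zero_dimension.
Qed.

(** Regular wreath product: [C] acts by translation on the base group of functions from [C] to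
    [V]. *)
Definition wreath (V C : finZmodType) : Type := ({ffun C -> V} * C)%type.

HB.instance Definition _ (V C : finZmodType) :=
  Finite.copy (wreath V C) ({ffun C -> V} * C)%type.

Section WreathGroup.
Local Open Scope ring_scope.
Variables V C : finZmodType.

Definition wreath_one : wreath V C := ([ffun=> 0], 0).
Definition wreath_mul (x y : wreath V C) : wreath V C :=
  ([ffun c => x.1 c + y.1 (c - x.2)], x.2 + y.2).
Definition wreath_inv (x : wreath V C) : wreath V C :=
  ([ffun c => - x.1 (c + x.2)], - x.2).

Lemma wreath_mulA : associative wreath_mul.
Proof.
move=> [f a] [g b] [h c]; congr (_, _); last exact: addrA.
by apply/ffunP => z; rewrite !ffunE /= !addrA opprD addrA.
Qed.

Lemma wreath_mul1 : left_id wreath_one wreath_mul.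
Proof.
move=> [f a]; congr (_, _); last exact: add0r.
by apply/ffunP => z; rewrite !ffunE /= add0r subr0.
Qed.

Lemma wreath_mulr1 : right_id wreath_one wreath_mul.
Proof.
move=> [f a]; congr (_, _); last exact: addr0.
by apply/ffunP => z; rewrite !ffunE /= addr0.
Qed.

Lemma wreath_mulV : left_inverse wreath_one wreath_inv wreath_mul.
Proof.
move=> [f a]; congr (_, _); last exact: addNr.
by apply/ffunP => z; rewrite !ffunE /= opprK addNr.
Qed.

Lemma wreath_mulrV : right_inverse wreath_one wreath_inv wreath_mul.
Proof.
move=> [f a]; congr (_, _); last exact: addrN.
by apply/ffunP => z; rewrite !ffunE /= subrK addrN.
Qed.

HB.instance Definition _ := isGroup.Build (wreath V C)
  wreath_mulA wreath_mul1 wreath_mulr1 wreath_mulV wreath_mulrV.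
End WreathGroup.

Lemma wreath_mulE (V C : finZmodType) (x y : wreath V C) :
  x * y = (([ffun c => x.1 c + y.1 (c - x.2)], x.2 + y.2)%R : wreath V C).
Proof. by []. Qed.

Lemma wreath_invE (V C : finZmodType) (x : wreath V C) :
  x^-1 = (([ffun c => - x.1 (c + x.2)], - x.2)%R : wreath V C).
Proof. by []. Qed.

Lemma wreath_oneE (V C : finZmodType) :
  1 = (([ffun=> 0], 0)%R : wreath V C).
Proof. by []. Qed.

(** On the base group the product is pointwise addition, so [w] becomes the linear combination of
    the [u i] whose coefficients are its exponent sums. *)
Lemma word_map_wreath p k (w : word k) (C : finZmodType)
    (u : 'I_k -> wreath 'F_p C) :
  (forall i, exponent_sum 'F_p w i = 0%R) -> (forall i, (u i).2 = 0%R) ->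
  word_map w u = 1.
Proof.
move=> w0 u0.
have -> : word_map w u =
    (([ffun c => \sum_(a <- sval w) (u a.1).1 c * (-1) ^+ a.2], 0)%R
      : wreath 'F_p C).
  rewrite /word_map; elim: (sval w : seq _) => [|[j b] s IH].
    rewrite big_nil wreath_oneE; congr (_, _).
    by apply/ffunP => c; rewrite !ffunE big_nil.
  rewrite big_cons IH; case: b => /=.
    rewrite wreath_invE wreath_mulE /= u0 oppr0 addr0; congr (_, _).
    apply/ffunP => c; rewrite !ffunE /= big_cons /=.
    by rewrite addr0 subr0 expr1 mulrN1.
  rewrite wreath_mulE /= u0 addr0; congr (_, _).
  apply/ffunP => c; rewrite !ffunE /= big_cons /=.
  by rewrite subr0 expr0 mulr1.
rewrite wreath_oneE; congr (_, _); apply/ffunP => c; rewrite !ffunE.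
rewrite (partition_big (fun a => a.1) xpredT)//= big1// => i _.
under eq_bigr => a /eqP -> do [].
by rewrite -big_distrr/= -/(exponent_sum 'F_p w i) w0 mulr0.
Qed.

(** * Haar measure of a kernel, and the choice of [q] *)

Lemma open_measurable_borel (G : topologicalGroupType) (A : set G) :
  open A -> measurable (A : set (borel G)).
Proof. exact: sub_sigma_algebra. Qed.

Lemma fsbig_finType (R : realType) (T : finType) (f : T -> \bar R) :
  (\sum_(t \in [set: T]) f t = \sum_(t : T) f t)%E.
Proof.
have -> : [set: T] = [set` enum T].
  by apply/seteqP; split=> t //= _; rewrite mem_enum.
by rewrite -fsbig_seq ?enum_uniq// big_enum.
Qed.

(** The fibres over the points [y t] are disjoint translates of the kernel, so their equal measures
    add up to at most 1. *)
Lemma haar_kernel_le (R : realType) (G K : topologicalGroupType)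
    (mu : probability (borel G) R) (phi : G -> K) (T : finType) (y : T -> K) :
  haar_measure mu -> continuous_morphism phi -> (forall z : K, open [set z]) ->
  injective y -> (forall t, exists g, phi g = y t) ->
  (mu (phi @^-1` [set 1%g]) * (#|T|%:R)%:E <= 1)%E.
Proof.
move=> [mu_inv _] [phiM cphi] o1 y_inj /choice[g phig].
pose W := phi @^-1` [set (1 : K)].
have mphi z : measurable (phi @^-1` [set z] : set (borel G)).
  by apply: open_measurable_borel; move/continuousP : cphi; exact.
pose A t : set (borel G) := [set g t * (x : G) | x in W].
have AE t : A t = phi @^-1` [set y t].
  apply/seteqP; split=> [z [x Wx <-]|z zt].
    by rewrite /preimage/= phiM phig Wx mulg1.
  exists ((g t)^-1 * z); last by rewrite mulgA mulgV mul1g.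
  apply: (@mulgI _ (phi (g t))); rewrite -phiM mulgA mulgV mul1g mulg1 phig.
  exact: zt.
have mA t : measurable (A t) by rewrite AE.
have tA : trivIset [set: T] A.
  move=> s t _ _; rewrite !AE => -[x [/= xs xt]].
  by apply: y_inj; rewrite -xs -xt.
have finT : finite_set [set: T] by exact: finite_finset.
have muA t : mu (A t) = mu W by apply: mu_inv; exact: mphi.
have : (mu (\bigcup_(t in [set: T]) A t) <= 1)%E.
  by apply: probability_le1; apply: fin_bigcup_measurable.
rewrite measure_fin_bigcup// fsbig_finType.
rewrite (eq_bigr (fun=> mu W)) => [|t _]; last exact: muA.
rewrite -/W -(fineK (fin_num_measure mu _ (mphi 1))) sumEFin sumr_const.
by rewrite -(mulr_natr (fine _)) EFinM.
Qed.

Lemma exists_prime_expn_ge M d : exists2 q, prime q & (M * q ^ d <= 2 ^ q.-1)%N.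
Proof.
(* With [t = q %/ d.+1], both [q <= d.+1 * 2 ^ t] and [N <= 2 ^ t] hold, so [2 * M * q ^ d <= N * 2
   ^ (t * d) <= 2 ^ q]. The factor 2 in [N] pays for the exponent [q.-1]. *)
pose N := (2 * M * d.+1 ^ d)%N.
have [q qN q_pr] := prime_above (N.+1 * d.+1)%N; exists q => //.
have q0 := prime_gt0 q_pr.
rewrite -(leq_pmul2l (isT : 0 < 2)%N) -expnS prednK// mulnA.
pose t := (q %/ d.+1)%N.
have qt : (q <= d.+1 * 2 ^ t)%N.
  rewrite (leq_trans (ltnW (ltn_ceil q (ltn0Sn d))))// mulnC leq_mul2l.
  exact: ltn_expl.
have tN : (N <= 2 ^ t)%N.
  rewrite ltnW// (leq_trans _ (ltnW (ltn_expl t (isT : 1 < 2)%N)))//.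
  by rewrite leq_divRL// ltnW.
apply: (@leq_trans (2 * M * (d.+1 * 2 ^ t) ^ d)%N).
  rewrite leq_mul2l; apply/orP; right.
  by have [->|d0] := posnP d; rewrite ?expn0// leq_exp2r.
rewrite expnMn mulnA -/N -expnM.
apply: (@leq_trans (2 ^ t * 2 ^ (t * d))%N); first by rewrite leq_mul2r tN orbT.
by rewrite -expnD -mulnS leq_exp2l// leq_trunc_div.
Qed.

(** * Homomorphisms into wreath products and their kernels *)

Lemma comp_continuous_morphism (F : topologicalGroupType) (G K : groupType)
    (f : F -> discrete_topology G) (h : G -> K) :
  continuous_morphism f -> {morph h : x y / x * y} ->
  continuous_morphism (h \o f : F -> discrete_topology K).
Proof.
move=> [fM cf] hM; split; first by move=> x y; rewrite /= fM hM.
move=> x; apply: (continuous_comp (f := f)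
  (g := h : discrete_topology G -> discrete_topology K)); first exact: cf.
move=> A /= /nbhs_singleton Ax.
apply: (@filterS _ (nbhs (f x)) _ [set f x]); last exact: discrete_set1.
by move=> y ->.
Qed.

(** Elements with zero base part form a multiplicative copy of [D]. Passing to it lets the top
    components of two maps be compared by the uniqueness clause of freeness. *)
Lemma wreath_snd_morph (V C D : finZmodType) (g : C -> D) :
  {morph g : a b / (a + b)%R} ->
  {morph (fun x => ([ffun=> 0], g x.2)%R : wreath V D) :
     x y / (x : wreath V C) * y >-> x * y}.
Proof.
move=> gD x y; rewrite !wreath_mulE /= gD; congr (_, _).
by apply/ffunP => c; rewrite !ffunE addr0.
Qed.

Section Kernel.
Local Open Scope ring_scope.
Variables (p q : nat) (F : topologicalGroupType).
Variable phi : F -> discrete_topology (wreath 'F_p 'F_q).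
Hypotheses (p_pr : prime p) (q_pr : prime q) (phi_cm : continuous_morphism phi).

Let I (f : {ffun 'F_q -> 'F_p}) :=
  exists t, phi t = ((f, 0) : wreath 'F_p 'F_q).

Let phiX t n : phi (t ^+ n)%g = (phi t ^+ n)%g.
Proof.
case: phi_cm => phiM _; elim: n => [|n IH]; last by rewrite !expgS phiM IH.
by apply: (@mulgI _ (phi 1%g)); rewrite -phiM !expg0 !mulg1.
Qed.

Let phiV t : phi t^-1%g = (phi t)^-1%g.
Proof.
case: phi_cm => phiM _; apply: (@mulgI _ (phi t)).
by rewrite -phiM !mulgV -(expg0 t) phiX.
Qed.

Lemma wreath_image_sub x y (a b : 'F_q) :
  b != 0 ->
  phi x = (([ffun c => (c == 0)%:R], a) : wreath 'F_p 'F_q) ->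
  phi y = (([ffun=> 0], b) : wreath 'F_p 'F_q) ->
  forall c, I [ffun z => (z == c)%:R - (z == 0)%:R].
Proof.
move=> b0 phix phiy c; case: (phi_cm) => phiM _.
(* As [q] is prime, [b] generates ['F_q], and [s] is the multiple with [b *+ s = c]. Conjugation by
   [y ^+ s] moves the point mass of [x] from 0 to [c], and the commutator cancels the top
   component. *)
pose s := (c / b : 'F_q) : nat.
have ys : phi (y ^+ s)%g = (([ffun=> 0], c) : wreath 'F_p 'F_q).
  have -> : c = b *+ s by rewrite -mulr_natl natr_Zp divfK.
  rewrite phiX phiy; elim: {c}s => [|s IH]; first by rewrite expg0.
  rewrite expgS IH wreath_mulE mulrS; congr (_, _).
  by apply/ffunP => z; rewrite !ffunE addr0.
exists (y ^+ s * x * (y ^+ s)^-1 * x^-1)%g.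
rewrite !phiM !phiV ys phix !wreath_invE !wreath_mulE /=; congr (_, _).
  apply/ffunP => z; rewrite !ffunE /= ?add0r ?addr0 ?oppr0 ?addr0.
  by rewrite (addrC c a) addrK subrK subr_eq0.
by rewrite (addrC c a) addrK subrr.
Qed.

Lemma wreath_kernel_le (R : realType) (mu : probability (borel F) R) x y
    (a b : 'F_q) :
  haar_measure mu -> b != 0 ->
  phi x = (([ffun c => (c == 0)%:R], a) : wreath 'F_p 'F_q) ->
  phi y = (([ffun=> 0], b) : wreath 'F_p 'F_q) ->
  (mu (phi @^-1` [set 1%g]) <= ((p ^ q.-1)%:R^-1)%:E)%E.
Proof.
move=> haar b0 phix phiy.
have Isub := wreath_image_sub b0 phix phiy.
have I0 : I 0.
  exists 1%g; case: phi_cm => phiM _.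
  by apply: (@mulgI _ (phi 1%g)); rewrite -phiM !mulg1.
have ID f g : I f -> I g -> I (f + g).
  move=> [s sf] [t tg]; exists (s * t)%g; case: phi_cm => phiM _.
  rewrite phiM sf tg wreath_mulE /= addr0; congr (_, _).
  by apply/ffunP => c; rewrite !ffunE subr0.
have IMn f n : I f -> I (f *+ n).
  by move=> If; elim: n => [|n IH]; rewrite ?mulrS//; exact: ID.
(* A function of sum zero is determined by its values off 0, so [T] indexes [p ^ q.-1] of them;
   [u f] is the one extending [f]. *)
pose T := {ffun {c : 'F_q | c != 0} -> 'F_p}.
pose E (c : 'F_q) : {ffun 'F_q -> 'F_p} :=
  [ffun z => (z == c)%:R - (z == 0)%:R].
pose u (f : T) := \sum_c E (val c) *+ f c.
have uE (f : T) (c : {c : 'F_q | c != 0}) : u f (val c) = f c.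
  rewrite /u sum_ffunE (bigD1 c)//= big1 => [|c' c'c].
    rewrite addr0 ffunMnE ffunE eqxx (negbTE (valP c)) subr0.
    exact: (natr_Zp (f c)).
  rewrite ffunMnE ffunE (negbTE (valP c)) subr0 (inj_eq val_inj) eq_sym.
  by rewrite (negbTE c'c) mul0rn.
have := @haar_kernel_le R F (discrete_topology (wreath 'F_p 'F_q)) mu phi T
  (fun f => ((u f, 0) : wreath 'F_p 'F_q)) haar phi_cm.
have cT : #|T| = (p ^ q.-1)%N.
  by rewrite card_ffun card_Fp// card_sig cardC1 card_Fp.
rewrite cT => /(_ _ _ _)/wrap[].
- by move=> z; exact: discrete_open.
- move=> f g [/ffunP fg]; apply/ffunP => c; rewrite -!uE; exact: fg.
- move=> f; apply: (big_ind I) => // c _; exact/IMn/Isub.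
have n0 : 0 < ((p ^ q.-1)%:R : R) by rewrite ltr0n expn_gt0 prime_gt0.
by rewrite -lee_pdivlMr// mul1e.
Qed.
End Kernel.

Lemma exponent_sum_eq0 p k (w : word k) (H : topologicalGroupType)
    (i : 'I_k) :
  prime p -> pro_p p H ->
  ~ (forall g : H, exists h : 'I_k -> H, word_map w h = g) ->
  exponent_sum 'F_p w i = 0%R.
Proof.
move=> pp pH nsurj; apply: contrapT => wi; apply: nsurj => g.
exact: word_map_pro_p_surj wi.
Qed.

Lemma continuous_morphism_word_map (F G : topologicalGroupType) (f : F -> G)
    k (w : word k) (h : 'I_k -> F) :
  continuous_morphism f -> f (word_map w h) = word_map w (f \o h).
Proof.
move=> [fM _].
have f1 : f 1 = 1 by apply: (@mulgI _ (f 1)); rewrite -fM !mulg1.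
rewrite /word_map (big_morph f fM f1); apply: eq_bigr => -[i []] _ //=.
by apply: (@mulgI _ (f (h i))); rewrite -fM !mulgV.
Qed.

(** * Covering the image of the word map by kernels *)

Section Cover.
Local Open Scope ring_scope.

Lemma exists_col_annihilator (K : fieldType) k d (M : 'M[K]_(k, d)) :
  (k < d)%N -> exists2 chi : 'cV[K]_d, chi != 0 & M *m chi = 0.
Proof.
move=> kd; have : cokermx M != 0.
  rewrite -mxrank_eq0 mxrank_coker -lt0n subn_gt0.
  exact: leq_ltn_trans (rank_leq_row M) kd.
move=> cM; have /existsP[j cj] : [exists j, col j (cokermx M) != 0].
  apply: contraNT cM; rewrite negb_exists => /forallP cM0.
  apply/eqP/matrixP => i j.
  by have /negPn/eqP/matrixP/(_ i 0) := cM0 j; rewrite !mxE.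
by exists (col j (cokermx M)) => //; rewrite colE mulmxA mulmx_coker mul0mx.
Qed.

Lemma word_image_cover (R : realType) d k p q (w : word k)
    (F : topologicalGroupType) (x : 'I_d -> F) (mu : probability (borel F) R) :
  free_in profinite x -> haar_measure mu -> prime p -> prime q ->
  (1 < d)%N -> (k < d)%N -> (forall i, exponent_sum 'F_p w i = 0) ->
  exists W : 'cV['F_q]_d -> set (borel F),
    [/\ forall chi, measurable (W chi),
        forall chi, (mu (W chi) <= ((p ^ q.-1)%:R^-1)%:E)%E &
        range (@word_map k w F) `<=` \bigcup_chi W chi].
Proof.
move=> [_ freex] haar pp qp d1 kd w0.
have prof (C : finZmodType) : profinite (discrete_topology (wreath 'F_p C)).
  by apply: finite_discrete_profinite; exact: (@finite_finset (wreath 'F_p C)).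
have hom (C : finZmodType) (y : 'I_d -> wreath 'F_p C) :
    exists2 f : F -> discrete_topology (wreath 'F_p C),
      continuous_morphism f & forall i, f (x i) = y i.
  have [f [[cf fx] _]] := freex (discrete_topology (wreath 'F_p C)) y (prof C).
  by exists f.
(* The top component of [psi] is the reduction of [F] to [F_q^d], sending the basis to the standard
   basis. *)
have [psi psi_cm psix] :=
  hom _ (fun i => ([ffun=> 0], delta_mx 0 i) : wreath 'F_p 'rV['F_q]_d).
have : forall chi : 'cV['F_q]_d, exists W : set (borel F),
    [/\ measurable W, (mu W <= ((p ^ q.-1)%:R^-1)%:E)%E &
      chi != 0 -> forall h : 'I_k -> F,
        (forall m, (psi (h m)).2 *m chi = 0) -> W (word_map w h)].
  move=> chi; have [->|chi0] := eqVneq chi 0.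
    exists set0; split=> //; rewrite measure0 lee_fin invr_ge0; exact: ler0n.
  have [j chij] : exists j, chi j 0 != 0.
    apply/existsP; apply: contraNT chi0; rewrite negb_exists => /forallP c0.
    by apply/eqP/colP => j; rewrite mxE; apply/eqP/negPn.
  (* The point mass is put on a generator [x i] other than [x j], so that [phi (x j)] is a pure
     translation by [chi j 0 != 0], as [wreath_kernel_le] requires. This uses [1 < d]. *)
  have [i ij] : exists i, i != j.
    have [j0|j0] := eqVneq j (Ordinal (ltnW d1)).
      by exists (Ordinal d1); rewrite j0.
    by exists (Ordinal (ltnW d1)); rewrite eq_sym.
  have [phi phi_cm phix] := hom _ (fun l =>
    ([ffun c : 'F_q => if l == i then (c == 0)%:R else 0], chi l 0)
      : wreath 'F_p 'F_q).
  have phi2 t : (phi t).2 = ((psi t).2 *m chi) 0 0.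
    pose g (v : 'rV['F_q]_d) := (v *m chi) 0 0.
    have gD : {morph g : a b / a + b}.
      by move=> a b; rewrite /g mulmxDl mxE.
    pose y l : discrete_topology (wreath 'F_p 'F_q) := ([ffun=> 0], chi l 0).
    (* Both sides, embedded as pure translations, are continuous homomorphisms agreeing on the
       basis, hence both equal [f0]. *)
    have [f0 [_ f0U]] := freex _ y (prof _).
    have e1 := f0U _ (conj (comp_continuous_morphism phi_cm
      (@wreath_snd_morph 'F_p _ _ id (fun a b => erefl))) _).
    have e2 := f0U _ (conj (comp_continuous_morphism psi_cm
      (@wreath_snd_morph 'F_p _ _ g gD)) _).
    suff : f0 t = ([ffun=> 0], (phi t).2) /\ f0 t = ([ffun=> 0], g (psi t).2).
      by move=> [-> []].
    split; [rewrite e1// => l|rewrite e2// => l]; first by rewrite /= phix.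
    rewrite /= psix; congr (_, _); rewrite /g mxE (bigD1 l)//= mxE !eqxx mul1r.
    by rewrite big1 ?addr0// => m ml; rewrite mxE (negbTE ml) andbF mul0r.
  exists (phi @^-1` [set 1%g]); split.
  - apply: open_measurable_borel; have /continuousP := phi_cm.2; apply.
    exact: discrete_open.
  - apply: (wreath_kernel_le pp qp phi_cm (x := x i) (y := x j) haar chij).
      by rewrite phix eqxx.
    by rewrite phix eq_sym (negbTE ij).
  - move=> _ h psi0; rewrite /preimage/=.
    rewrite (continuous_morphism_word_map _ _ phi_cm).
    by apply: word_map_wreath => // m; rewrite /= phi2 psi0 mxE.
move=> /choice[W WP]; exists W; split.
- by move=> chi; have [] := WP chi.
- by move=> chi; have [] := WP chi.
move=> _ [h _ <-].
pose M : 'M['F_q]_(k, d) := \matrix_m (psi (h m)).2.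
have [chi chi0 Mchi] := exists_col_annihilator M kd.
exists chi => //; have [_ _ ] := WP chi; apply=> // m.
by rewrite -(rowK (fun m => (psi (h m)).2)) -row_mul Mchi row0.
Qed.
End Cover.

Local Close Scope group_scope.
Unset Implicit Arguments.

Theorem corollary3p11 (R : realType) (d k p : nat) (w : word k)
    (F H : topologicalGroupType) (mu : probability (borel F) R)
    (hd : (2 <= d)%N)
    (hF : free_profinite d F) (hmu : haar_measure mu)
    (hp : prime p) (hH : free_pro_p p d H)
    (hw : ~ (forall g : H, exists h : 'I_k -> H, word_map w h = g))
    (hk : (k + 1 <= d)%N) :
  let image : set (borel F) := [set word_map w h | h in [set: 'I_k -> F]] in
  measurable image /\ mu image = 0%E.
Proof.
move=> image.
have [x xF] := hF; have [[cF hausF _] _] := xF.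
have [_ [pH _]] := hH.
have w0 i : exponent_sum 'F_p w i = 0%R by exact: exponent_sum_eq0 hp pH hw.
have mI : measurable image.
  (* The image is compact, hence closed, hence Borel. *)
  rewrite -[image]setCK; apply: measurableC; apply: open_measurable_borel.
  apply: closed_openC; apply: compact_closed hausF _.
  exact: compact_range_word_map.
split=> //; apply/eqP; rewrite eq_le measure_ge0 andbT.
apply/lee_addgt0Pr => e e0; rewrite add0e.
pose M := (Num.truncn (e^-1)%R).+1.
have [q q_pr Mq] := exists_prime_expn_ge M d.
have kd : (k < d)%N by rewrite -addn1.
have [W [mW muW IW]] := word_image_cover xF hmu hp q_pr hd kd w0.
have finT : finite_set [set: 'cV['F_q]_d] by exact: finite_finset.
have := content_sub_fsum mu finT (fun chi _ => mW chi) mI IW.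
rewrite fsbig_finType => /le_trans; apply.
(* The cover has total measure at most [q ^ d / p ^ q.-1], which is at most [1 / M < e] since
   [M * q ^ d <= 2 ^ q.-1 <= p ^ q.-1]. *)
apply: (@le_trans _ _ (\sum_(chi : 'cV['F_q]_d) ((p ^ q.-1)%:R^-1)%:E)%E).
  by apply: lee_sum => chi _; exact: muW.
rewrite sumEFin sumr_const card_mx card_Fp// muln1.
rewrite -(mulr_natl _ (q ^ d)) lee_fin.
have P0 : (0 < (p ^ q.-1)%:R :> R)%R by rewrite ltr0n expn_gt0 prime_gt0.
rewrite ler_pdivrMr//.
have eM : (e^-1 < M%:R)%R by exact: truncnS_gt.
rewrite -ler_pdivrMl//.
apply: (@le_trans _ _ (M * q ^ d)%:R%R).
  by rewrite natrM ler_wpM2r// ltW.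
rewrite ler_nat (leq_trans Mq)//.
have [->|q1] := posnP q.-1; first by rewrite !expn0.
by rewrite leq_exp2r// prime_gt1.
Qed.
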